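(* Let $F=\bigcup_{i=1}^k S_{d_i}$ be a star forest (the disjoint union of the stars $S_{d_1},\dots,S_{d_k}$) with $k\ge 2$ and $d_1\ge\cdots\ge d_k\ge 1$. If $G$ is an $F$-free graph of order $$n\ \ge\ \frac{\left(\sum_{i=1}^k 2d_i+5k-8\right)^4\left(\sum_{i=1}^k d_i+k-2\right)^4}{k-2},$$ then $$\rho(G)\le \frac{k+d_k-3+\sqrt{(k-d_k-1)^2+4(k-1)(n-k+1)}}{2},$$ with equality if and only if $G=K_{k-1}\nabla H$, where $H$ is a $(d_k-1)$-regular graph of order $n-k+1$. In particular, if $d_k=2$, then $\rho(G)\le\rho(F_{n,k})$, with equality if and only if $G=F_{n,k}$.
   Context: All graphs are finite, simple and undirected; the order of a graph is its number of vertices, and equality of graphs means isomorphism. $\rho(G)$ denotes the spectral radius of $G$, i.e. the largest eigenvalue of its adjacency matrix $A(G)$. $S_m$ denotes the star with $m$ edges (so of order $m+1$). A graph is $H$-free if it does not contain $H$ as a (not necessarily induced) subgraph. $G\cup H$ is the vertex-disjoint union, $pG$ is the union of $p$ disjoint copies of $G$, and $G\nabla H$ is the join, obtained from the disjoint union by joining every vertex of $G$ to every vertex of $H$. $K_m$ is the complete graph of order $m$. $F_{n,k}=K_{k-1}\nabla\big((pK_2)\cup K_s\big)$, where $n-(k-1)=2p+s$ and $0\le s<2$ ($K_0$ is the empty graph with no vertices).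
   Formalization: For k = 2 the lower bound on n divides by k − 2 = 0 and is undefined; the condition is stated as numerator ≤ n(k − 2), which no n satisfies for k = 2, so the theorem has content exactly for k ≥ 3. *)

(* Defs.v *)
From mathcomp Require Import all_boot all_order all_algebra.
From mathcomp Require Import boolp classical_sets reals.

Set Implicit Arguments.
Unset Strict Implicit.
Unset Printing Implicit Defensive.

Import Order.TTheory GRing.Theory Num.Theory.

Record sgraph := SGraph {
  vertex :> finType;
  adj : rel vertex;
  adj_sym : symmetric adj;
  adj_irr : irreflexive adj }.

Definition graph_order (G : sgraph) : nat := #|vertex G|.

Definition giso (G H : sgraph) : Prop :=
  exists f : G -> H, bijective f /\ forall x y, adj (f x) (f y) = adj x y.

Definition subgraph (H G : sgraph) : Prop :=
  exists f : H -> G, injective f /\ forall x y, adj x y -> adj (f x) (f y).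

Definition H_free (H G : sgraph) : Prop := ~ subgraph H G.

Definition is_regular (r : nat) (G : sgraph) : Prop :=
  forall x : G, #|[pred y : G | adj x y]| = r.

Section Complete.
Variable m : nat.
Definition complete_adj : rel 'I_m := fun x y => x != y.
Lemma complete_adj_sym : symmetric complete_adj.
Proof. by move=> x y; rewrite /complete_adj eq_sym. Qed.
Lemma complete_adj_irr : irreflexive complete_adj.
Proof. by move=> x; rewrite /complete_adj eqxx. Qed.
Definition complete : sgraph := SGraph complete_adj_sym complete_adj_irr.
End Complete.

(* The star with m edges, centred at ord0. *)
Section Star.
Variable m : nat.
Definition star_adj : rel 'I_m.+1 := fun x y => (x == ord0) (+) (y == ord0).
Lemma star_adj_sym : symmetric star_adj.
Proof. by move=> x y; rewrite /star_adj addbC. Qed.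
Lemma star_adj_irr : irreflexive star_adj.
Proof. by move=> x; rewrite /star_adj addbb. Qed.
Definition star : sgraph := SGraph star_adj_sym star_adj_irr.
End Star.

Section UnionJoin.
Variables G H : sgraph.
Definition union_adj : rel (G + H)%type := fun u v =>
  match u, v with
  | inl x, inl y => adj x y
  | inr x, inr y => adj x y
  | _, _ => false
  end.
Lemma union_adj_sym : symmetric union_adj.
Proof. by move=> [x|x] [y|y] //=; rewrite adj_sym. Qed.
Lemma union_adj_irr : irreflexive union_adj.
Proof. by move=> [x|x] /=; rewrite adj_irr. Qed.
Definition graph_union : sgraph := SGraph union_adj_sym union_adj_irr.

Definition join_adj : rel (G + H)%type := fun u v =>
  match u, v with
  | inl x, inl y => adj x y
  | inr x, inr y => adj x y
  | _, _ => true
  end.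
Lemma join_adj_sym : symmetric join_adj.
Proof. by move=> [x|x] [y|y] //=; rewrite adj_sym. Qed.
Lemma join_adj_irr : irreflexive join_adj.
Proof. by move=> [x|x] /=; rewrite adj_irr. Qed.
Definition graph_join : sgraph := SGraph join_adj_sym join_adj_irr.
End UnionJoin.

Section BigUnion.
Variables (I : finType) (G : I -> sgraph).
Definition bigunion_adj : rel {i : I & G i} := fun u v =>
  (tag u == tag v) && adj (tagged u) (tagged_as u v).
Lemma bigunion_adj_sym : symmetric bigunion_adj.
Proof.
move=> [i x] [j y]; rewrite /bigunion_adj /= eq_sym.
case: (eqVneq j i) => //= eij; subst j.
by rewrite !tagged_asE adj_sym.
Qed.
Lemma bigunion_adj_irr : irreflexive bigunion_adj.
Proof. by move=> [i x]; rewrite /bigunion_adj /= eqxx tagged_asE adj_irr. Qed.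
Definition bigunion : sgraph := SGraph bigunion_adj_sym bigunion_adj_irr.
End BigUnion.

Definition copies (p : nat) (G : sgraph) : sgraph :=
  bigunion (fun _ : 'I_p => G).

(* The degrees are d 1, ..., d k; the value d 0 is not used. *)
Definition star_forest (k : nat) (d : nat -> nat) : sgraph :=
  bigunion (fun i : 'I_k => star (d i.+1)).

Definition F_graph (n k : nat) : sgraph :=
  let m := n - (k - 1) in
  graph_join (complete (k - 1))
       (graph_union (copies (m %/ 2) (complete 2)) (complete (m %% 2))).

Local Open Scope ring_scope.

Definition adjmx (R : realType) (G : sgraph) : 'M[R]_(graph_order G) :=
  \matrix_(i, j) (adj (enum_val i) (enum_val j))%:R.

(* The largest real eigenvalue of a square matrix; it exists for a real
   symmetric matrix of positive size, and the default value is 0. *)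
Definition largest_eigenvalue (R : realType) (n : nat) (A : 'M[R]_n) : R :=
  xget 0 [set a | eigenvalue A a /\ forall b, eigenvalue A b -> b <= a]%classic.

Definition spectral_radius (R : realType) (G : sgraph) : R :=
  largest_eigenvalue (adjmx R G).

Definition rho_bound (R : realType) (n k dk : nat) : R :=
  (k%:R + dk%:R - 3
   + Num.sqrt ((k%:R - dk%:R - 1) ^+ 2 + 4 * (k%:R - 1) * (n%:R - k%:R + 1)))
  / 2.

(* Main.v *)
Require Import Defs.
From mathcomp Require Import all_boot all_order all_algebra.
From mathcomp Require Import reals.
From mathcomp Require classical_sets.
From mathcomp Require Import zify ring lra.

(**
Let D be the sum of the d_i and L the set of vertices of degree at least
D + k - 1.  Stars centred at vertices of L can be chosen greedily, so an
F-free graph has |L| < k, and if |L| = k - 1 then G - L has maximum degree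
at most d_k - 1 (otherwise a star S_{d_k} in G - L completes the forest).

If positive weights z satisfy A z <= t z entrywise, every eigenvalue of A is at
most t, as one sees at a maximizer of |y_v| / z_v for an eigenvector y; if t is
itself an eigenvalue, the inequality is tight at that maximizer and all its
neighbours are maximizers too.  For |L| <= k - 2, weights constant on L and on
its complement give eigenvalues below sqrt((k - 1)(n - k + 1)) because n is
large.  For |L| = k - 1, the same kind of weights give the stated bound, which
satisfies (t - (k - 2))(t - (d_k - 1)) = (k - 1)(n - k + 1); tightness forces
every vertex of L to be adjacent to all others and G - L to be regular.

For d_k = 2 and |L| = k - 1, G - L is a matching with isolated vertices, so G
is a spanning subgraph of F_{n,k}, and the weights are the positive eigenvector
of F_{n,k}.  No existence theorem for eigenvalues is needed, since the extremal
graphs have explicit positive eigenvectors.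
*)

Set Implicit Arguments.
Unset Strict Implicit.
Unset Printing Implicit Defensive.
Import Order.TTheory GRing.Theory Num.Theory.

(** * Embedding star forests *)

Definition neighbours (G : sgraph) (v : G) : {set G} := [set u | adj v u].

Lemma in_neighbours (G : sgraph) (v u : G) : (u \in neighbours v) = adj v u.
Proof. by rewrite inE. Qed.

Lemma exists_subset_card (T : finType) (A : {set T}) m :
  m <= #|A| -> exists2 B : {set T}, B \subset A & #|B| = m.
Proof.
move=> mA; exists [set x in take m (enum A)].
  by apply/subsetP => x; rewrite inE => /mem_take; rewrite mem_enum.
rewrite cardsE (card_uniqP (take_uniq _ (enum_uniq _))) size_take -cardE.
by case: ltnP => // Am; apply/eqP; rewrite eqn_leq mA Am.
Qed.

(** The sets are picked from the last index down to the first. When [S i] is picked, the later sets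
    occupy at most the sum of the later [e j], so a tail sum is all the room that [N i] needs. *)
Lemma exists_disjoint_subsets (T : finType) k (N : nat -> {set T}) (e : nat -> nat) :
  (forall i, i < k -> \sum_(i <= j < k) e j <= #|N i|) ->
  exists S : nat -> {set T},
    [/\ forall i, i < k -> S i \subset N i, forall i, i < k -> #|S i| = e i
      & forall i j, i < k -> j < k -> i != j -> [disjoint S i & S j]].
Proof.
elim: k N e => [|k IH] N e hN; first by exists (fun=> finset.set0); split.
have [i ik|S [SN Se Sd]] := IH (fun i => N i.+1) (fun i => e i.+1).
  by have := hN i.+1 ik; rewrite big_add1.
pose U := \bigcup_(i < k) S i.
have cU : #|U| <= \sum_(0 <= i < k) e i.+1.
  rewrite big_mkord; apply: leq_trans (_ : \sum_(i < k) #|S i| <= _); last first.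
    by apply: leq_sum => i _; rewrite Se.
  rewrite /U; elim/big_ind2: _ => // [|A m B p hA hB]; first by rewrite cards0.
  by apply: leq_trans (leq_card_setU _ _) _; rewrite leq_add.
have [S0 S0N S0e] : exists2 B : {set T}, B \subset N 0 :\: U & #|B| = e 0.
  apply: exists_subset_card; have := hN 0 isT.
  rewrite big_nat_recl // => h0.
  have := cardsID U (N 0); have := subset_leq_card (subsetIr (N 0) U); lia.
have S0d i : i < k -> [disjoint S0 & S i].
  move=> ik; rewrite disjoint_subset; apply/subsetP => x /(subsetP S0N).
  rewrite !inE => /andP[/negP xU _]; apply/negP => xS; apply: xU.
  by apply/bigcupP; exists (Ordinal ik).
exists (fun i => if i is i'.+1 then S i' else S0); split.
- by case=> [_|i /SN //]; apply: subset_trans S0N (subsetDl _ _).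
- by case=> [|i /Se].
case=> [|i] [|j] // ik jk ij; first exact: S0d.
- by rewrite disjoint_sym; apply: S0d.
- exact: Sd.
Qed.

Lemma star_forest_subgraph (G : sgraph) k (d : nat -> nat) (v0 : G) (cs : seq G) :
  uniq cs -> size cs = k ->
  (forall i, i < k -> \sum_(i <= j < k) d j.+1 <=
                      #|neighbours (nth v0 cs i) :\: [set x in cs]|) ->
  subgraph (star_forest k d) G.
Proof.
move=> ucs scs hN.
pose c i := nth v0 cs i.
have [S [SN Sd Sdisj]] := exists_disjoint_subsets hN.
have cP i : i < k -> c i \in cs by move=> ik; rewrite mem_nth ?scs.
have SNcs i x : i < k -> x \in S i -> (x \notin cs) && adj (c i) x.
  by move=> ik /(subsetP (SN i ik)); rewrite !inE.
(* Entry 0 is the centre, in agreement with [ord0] in [star]; the leaves follow. *)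
pose s i := c i :: enum (S i).
have us i : i < k -> uniq (s i).
  move=> ik /=; rewrite enum_uniq andbT mem_enum; apply/negP => /(SNcs _ _ ik).
  by rewrite cP.
have ss i : i < k -> size (s i) = (d i.+1).+1 by move=> ik /=; rewrite -cardE Sd.
pose f (u : star_forest k d) : G := nth v0 (s (tag u)) (tagged u).
have fS (u : star_forest k d) : f u \in s (tag u).
  by rewrite /f mem_nth // ss //; case: u => i x.
exists f; split.
- move=> u w fuw.
  have tuw : tag u = tag w.
    apply/eqP; apply/negPn/negP => ne.
    have {}ne : (tag u : nat) != tag w by apply: contra ne => /eqP/val_inj->.
    have := fS w; rewrite -fuw; have := fS u.
    have ku := ltn_ord (tag u); have kw := ltn_ord (tag w).
    rewrite !inE !mem_enum => /orP[/eqP->|xu] /orP[|xw].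
    + by rewrite nth_uniq ?scs // (negPf ne).
    + by have := SNcs _ _ kw xw; rewrite cP.
    + by move=> /eqP xw; have := SNcs _ _ ku xu; rewrite xw cP.
    + by rewrite (disjointFr (Sdisj _ _ ku kw ne) xu) in xw.
  case: u w tuw fuw => i x [j y] /= tij; move: tij y => <- y.
  rewrite /f /= => /eqP; rewrite (nth_uniq v0 _ _ (us i _)) ?ss //.
  by move=> /eqP/val_inj->.
- move=> [i x] [j y]; rewrite /= /bigunion_adj /= => /andP[/eqP ij].
  move: ij y => <- y; rewrite tagged_asE /star_adj /f /=.
  have nthS z : z < d i.+1 -> adj (c i) (nth v0 (enum (S i)) z).
    move=> hz; suff /(SNcs _ _ (ltn_ord i))/andP[] : nth v0 (enum (S i)) z \in S i by [].
    by rewrite -mem_enum mem_nth // -cardE Sd.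
  case: x y => [[|x] hx] [[|y] hy] //= _; first exact: nthS.
  by rewrite adj_sym; apply: nthS.
Qed.

(** * Vertices of large degree in F-free graphs *)

Section FreeGraphs.
Variables (G : sgraph) (k : nat) (d : nat -> nat).
Hypothesis Gfree : H_free (star_forest k d) G.
Let D := \sum_(1 <= i < k.+1) d i.

Definition large_vertices (t : nat) : {set G} := [set v | t <= #|neighbours v|].

Let tail_sum i : \sum_(i <= j < k) d j.+1 <= D.
Proof.
rewrite /D big_add1 /=; case: (leqP i k) => ik; last by rewrite big_geq // ltnW.
by rewrite (big_cat_nat (m := 0) (n := i)) //= leq_addl.
Qed.

(** Being itself one of the k centres, [v] has at most k - 1 neighbours among them, which leaves D
    for leaves. *)
Let large_outside (cs : seq G) v :
  size cs = k -> v \in cs -> v \in large_vertices (D + k - 1) ->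
  D <= #|neighbours v :\: [set x in cs]|.
Proof.
move=> scs vcs; rewrite inE => hv.
have := cardsID [set x in cs] (neighbours v).
have : #|neighbours v :&: [set x in cs]| < k; last by lia.
rewrite -scs; apply: leq_trans (card_size _).
apply: leq_ltn_trans (_ : #|[predD1 cs & v]| < _).
  apply: subset_leq_card; apply/subsetP => x; rewrite !inE => /andP[vx ->].
  by rewrite andbT; apply: contraTneq vx => ->; rewrite adj_irr.
by rewrite [X in _ < X](cardD1 v) vcs.
Qed.

Lemma card_large_vertices : 0 < k -> #|large_vertices (D + k - 1)| < k.
Proof.
move=> k0; rewrite ltnNge; apply/negP => kL; apply: Gfree.
set L := large_vertices _ in kL.
have [v0 _] : exists v0, v0 \in L by apply/card_gt0P; apply: leq_trans kL.
have sz : size (take k (enum L)) = k by rewrite size_takel // -cardE.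
apply: (@star_forest_subgraph _ _ _ v0 (take k (enum L))) => //.
  by rewrite take_uniq ?enum_uniq.
move=> i ik; apply: leq_trans (tail_sum i) _; apply: large_outside => //.
  by rewrite mem_nth ?sz.
have : nth v0 (take k (enum L)) i \in take k (enum L) by rewrite mem_nth ?sz.
by move=> /mem_take; rewrite mem_enum.
Qed.

(** The vertex [v] is listed last among the centres, so its tail sum is the single term [d k]; the
    centres in L have room for any tail sum. *)
Lemma card_neighbours_outside v :
  #|large_vertices (D + k - 1)|.+1 = k -> v \notin large_vertices (D + k - 1) ->
  #|neighbours v :\: large_vertices (D + k - 1)| < d k.
Proof.
set L := large_vertices _ => cL vL; rewrite ltnNge; apply/negP => dk; apply: Gfree.
have sz : size (rcons (enum L) v) = k by rewrite size_rcons -cardE.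
apply: (@star_forest_subgraph _ _ _ v (rcons (enum L) v)) => //.
  by rewrite rcons_uniq enum_uniq mem_enum vL.
move=> i ik; rewrite nth_rcons -cardE.
case: ltngtP => [iL|Li|->]; last 1 first.
- have -> : \sum_(#|L| <= j < k) d j.+1 = d k by rewrite -cL big_nat1.
  apply: leq_trans dk (subset_leq_card _); apply/subsetP => x.
  rewrite 2!in_setD => /andP[xL vx].
  rewrite vx andbT in_set mem_rcons inE mem_enum negb_or xL andbT.
  rewrite in_neighbours in vx.
  by apply: contraTneq vx => ->; rewrite adj_irr.
- apply: leq_trans (tail_sum i) _; apply: large_outside => //.
    by rewrite mem_rcons inE mem_nth ?orbT // -cardE.
  by rewrite -/L -mem_enum mem_nth // -cardE.
- by move: ik; rewrite -cL ltnS leqNgt Li.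
Qed.

End FreeGraphs.

(** * Matchings *)

(* Matched vertices are listed consecutively, so that halving the index
   identifies the pairs. *)
Lemma matching_enumeration (G : sgraph) (A : {set G}) :
  (forall v, v \in A -> #|neighbours v :&: A| <= 1) ->
  exists s : seq G, [/\ uniq s, s =i A &
    forall x y, x \in A -> y \in A -> adj x y -> (index x s)./2 = (index y s)./2].
Proof.
have [m] := ubnP #|A|; elim: m A => // m IH A Am hA.
have [/existsP[x /existsP[y /and3P[xA yA xy]]]|none] :=
    boolP [exists x, exists y, [&& x \in A, y \in A & adj x y]]; last first.
  exists (enum A); split; [exact: enum_uniq|by move=> x; rewrite mem_enum|].
  move=> x y xA yA xy; case/negP: none; apply/existsP; exists x.
  by apply/existsP; exists y; rewrite xA yA.
have xNy : x != y by apply: contraTneq xy => ->; rewrite adj_irr.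
have mate u v w : u \in A -> v \in A -> w \in A -> adj u v -> adj u w -> v = w.
  move=> uA vA wA uv uw; have /card_le1_eqP := hA u uA.
  by apply; rewrite !inE ?vA ?wA andbT.
pose B := A :\ x :\ y.
have [||s [us sB hs]] := IH B.
- by have := cardsD1 x A; have := cardsD1 y (A :\ x); rewrite !inE xA yA eq_sym xNy /B; lia.
- move=> v; rewrite !inE => /and3P[_ _ vA]; apply: leq_trans (hA v vA).
  by apply/subset_leq_card/setIS; rewrite /B !subDset; apply/subsetP => w;
     rewrite !inE => ->; rewrite !orbT.
have BE w : (w \in B) = [&& w != y, w != x & w \in A] by rewrite !inE.
exists [:: x, y & s]; split.
- by rewrite /= !inE negb_or xNy !sB !BE !eqxx /= andbF us.
- move=> w; rewrite !inE sB BE; have [->|wx] := eqVneq w x; first by rewrite xA.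
  by have [->|wy] := eqVneq w y; rewrite ?yA.
move=> u w uA wA uw; rewrite /=.
have [xu|xu] := eqVneq x u.
  have <- : y = w by apply: (mate x) => //; rewrite xu.
  by rewrite (negPf xNy) eqxx.
have [yu|yu] := eqVneq y u.
  have <- : x = w by apply: (mate y); rewrite // ?yu // adj_sym -yu.
  by rewrite eqxx.
have [xw|xw] := eqVneq x w.
  by case/eqP: yu; apply: (mate x) => //; rewrite xw adj_sym.
have [yw|yw] := eqVneq y w.
  by case/eqP: xu; apply: (mate y) => //; rewrite ?yw adj_sym // -yw.
by rewrite /= (hs u w) // BE ?uA ?wA ![_ == x]eq_sym ![_ == y]eq_sym ?xu ?yu ?xw ?yw.
Qed.

Definition matching_graph (p s : nat) : sgraph :=
  graph_union (copies p (complete 2)) (complete s).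

(** Edge i gets the codes 2i and 2i + 1, and a leftover vertex the code 2p, so for s < 2 equal
    halves mean the same component, as in [matching_enumeration]. *)
Definition matching_code p s (u : matching_graph p s) : nat :=
  match u with inl w => (tag w : nat).*2 + tagged w | inr x => p.*2 + x end.

Lemma matching_code_lt p s (u : matching_graph p s) : matching_code u < p.*2 + s.
Proof.
case: u => [[i x]|x] /=; last by rewrite ltn_add2l.
by have := ltn_ord i; have := ltn_ord x; lia.
Qed.

Lemma matching_code_inj p s : injective (@matching_code p s).
Proof.
move=> [[i x]|x] [[j y]|y] /= e.
- have ij : i = j by apply: val_inj; have := ltn_ord x; have := ltn_ord y => /=; lia.
  by move: ij y e => <- y /addnI/val_inj->.
- by have := ltn_ord i; have := ltn_ord x; lia.
- by have := ltn_ord j; have := ltn_ord y; lia.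
- by congr inr; apply: val_inj; move: e => /addnI.
Qed.

Lemma matching_code_adj p s (u w : matching_graph p s) : s < 2 ->
  u != w -> (matching_code u)./2 = (matching_code w)./2 -> adj u w.
Proof.
move=> s2; case: u w => [[i x]|x] [[j y]|y] /= uw e.
- have ij : i = j by apply: val_inj; have := ltn_ord x; have := ltn_ord y => /=; lia.
  rewrite /bigunion_adj /=; move: ij y e uw => <- y e uw.
  rewrite eqxx tagged_asE /= /complete_adj; apply: contraNneq uw => ->; exact: eqxx.
- by have := ltn_ord i; have := ltn_ord x; lia.
- by have := ltn_ord j; have := ltn_ord y; lia.
- by case/eqP: uw; congr inr; apply: val_inj => /=; have := ltn_ord x; have := ltn_ord y; lia.
Qed.

(** The bijection is built backwards, from codes to positions in the matching enumeration. An edge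
    of [G] outside [L] joins positions with equal halves, hence lies in the matching; every edge
    meeting [L] is present in the join. *)
Lemma embed_join_matching (G : sgraph) (L : {set G}) p s :
  0 < #|L| -> s < 2 -> (forall v, v \notin L -> #|neighbours v :\: L| <= 1) ->
  #|G| = #|L| + (p.*2 + s) ->
  exists2 f : G -> graph_join (complete #|L|) (matching_graph p s),
    bijective f & forall x y, adj x y -> adj (f x) (f y).
Proof.
move=> L0 s2 hL cG.
have [v|e [ue eE eadj]] := @matching_enumeration G (~: L).
  by rewrite inE => vL; rewrite -finset.setDE hL.
have se : size e = p.*2 + s.
  rewrite -(card_uniqP ue) (eq_card eE).
  by have := cardsC L; rewrite cG; lia.
pose F := graph_join (complete #|L|) (matching_graph p s).
have /card_gt0P[v0 _] := L0.
pose g (w : F) : G :=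
  match w with inl i => enum_val i | inr u => nth v0 e (matching_code u) end.
have gL (i : 'I_#|L|) : enum_val i \in L by apply: enum_valP.
have ge u : nth v0 e (@matching_code p s u) \in ~: L.
  by rewrite -eE mem_nth // se matching_code_lt.
have ginj : injective g.
  move=> [i|u] [j|w] /= E.
  - by rewrite (enum_val_inj E).
  - by have := ge w; rewrite -E inE gL.
  - by have := ge u; rewrite E inE gL.
  - congr inr; apply: matching_code_inj; apply/eqP.
    by rewrite -(nth_uniq v0 _ _ ue) ?E ?se ?matching_code_lt.
have [f gK fK] : bijective g.
  apply: inj_card_bij ginj _; rewrite cG /F /= !card_sum !card_ord card_tagged.
  rewrite sumnE big_map big_enum /= sum_nat_const !card_ord; lia.
exists f; first by exists g.
have gadj u w : adj (g u) (g w) -> adj u w.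
  case: u w => [i|u] [j|w] //=.
    by rewrite /complete_adj; apply: contraTneq => ->; rewrite adj_irr.
  move=> uw; have := eadj _ _ (ge u) (ge w) uw.
  rewrite !index_uniq ?se ?matching_code_lt //.
  by apply: matching_code_adj => //; apply: contraTneq uw => ->; rewrite adj_irr.
by move=> x y; rewrite -{1}(fK x) -{1}(fK y); apply: gadj.
Qed.

Local Open Scope ring_scope.

(** * Eigenvalues and positive weights *)

Section Eigenvalues.
Variable R : realType.

Lemma eigenvalue_adjmxP (G : sgraph) (a : R) :
  eigenvalue (adjmx R G) a <->
  exists2 y : G -> R, exists v, y v != 0
                    & forall v, \sum_(u | adj v u) y u = a * y v.
Proof.
split=> [/eigenvalueP[x xA x0]|[y [v yv] yA]].
- exists (fun u => x ord0 (enum_rank u)) => [|v].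
    have [j xj] : exists j, x ord0 j != 0.
      apply/existsP; apply: contraNT x0; rewrite negb_exists => /forallP h.
      by apply/eqP/rowP => j; rewrite mxE; apply/eqP; have := h j; rewrite negbK.
    by exists (enum_val j); rewrite enum_valK.
  have := congr1 (fun M : 'rV_ _ => M ord0 (enum_rank v)) xA.
  rewrite !mxE => <-.
  rewrite [LHS](reindex _ (onW_bij _ (@enum_val_bij G))) /= big_mkcond /=.
  apply: eq_bigr => i _; rewrite !mxE enum_rankK enum_valK adj_sym.
  by case: adj; rewrite ?mulr1 ?mulr0.
- apply/eigenvalueP; exists (\row_i y (enum_val i)).
    apply/rowP => j; rewrite !mxE -yA.
    rewrite [RHS](reindex _ (onW_bij _ (@enum_val_bij G))) /= [RHS]big_mkcond /=.
    apply: eq_bigr => i _; rewrite !mxE [adj _ (enum_val j)]adj_sym.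
    by case: adj; rewrite ?mulr1 ?mulr0.
  apply: contraNneq yv => /rowP /(_ (enum_rank v)).
  by rewrite !mxE enum_rankK => ->.
Qed.

Section PositiveWeights.
Variables (G : sgraph) (z : G -> R) (t : R).
Hypothesis z_gt0 : forall v, 0 < z v.
Hypothesis zP : forall v, \sum_(u | adj v u) z u <= t * z v.

(* [M] is the maximum of [`|y v| / z v] for an eigenvector [y]. *)
Let maximizers (a : R) : eigenvalue (adjmx R G) a ->
  exists y M, [/\ 0 < M, forall v, \sum_(u | adj v u) y u = a * y v,
                 forall u, `|y u| <= M * z u & exists v, `|y v| = M * z v].
Proof.
move=> /eigenvalue_adjmxP[y [v0 y0] yA]; exists y.
case: (@arg_maxP _ _ _ v0 predT (fun u => `|y u| / z u)) => // v _ hv.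
exists (`|y v| / z v); split=> //.
- by apply: lt_le_trans (hv v0 isT); rewrite divr_gt0 ?normr_gt0.
- by move=> u; rewrite -ler_pdivrMr //; apply: hv.
- by exists v; rewrite divfK // gt_eqF.
Qed.

(** At a maximizer v, a|y v| is at most the sum of |y u| over the neighbours u, hence at most M
    times the sum of z u, hence at most t M z v = t|y v|. *)
Lemma eigenvalue_le a : eigenvalue (adjmx R G) a -> a <= t.
Proof.
move=> /maximizers[y [M [M0 yA yM [v yv]]]].
rewrite -(ler_pM2r (_ : 0 < `|y v|)); last by rewrite yv mulr_gt0.
apply: le_trans (_ : `|a * y v| <= _).
  by rewrite normrM ler_wpM2r // ler_norm.
rewrite -yA; apply: le_trans (ler_norm_sum _ _ _) _.
apply: le_trans (_ : \sum_(u | adj v u) M * z u <= _).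
  by apply: ler_sum => u _; apply: yM.
by rewrite -mulr_sumr yv mulrCA ler_wpM2l // ltW.
Qed.

Lemma eigenvalue_tight :
  eigenvalue (adjmx R G) t ->
  exists2 S : {set G}, exists v, v \in S &
    forall v, v \in S -> \sum_(u | adj v u) z u = t * z v
                         /\ forall u, adj v u -> u \in S.
Proof.
move=> /maximizers[y [M [M0 yA yM [v0 yv0]]]].
exists [set v | `|y v| == M * z v]; first by exists v0; rewrite inE yv0.
move=> v; rewrite inE => /eqP yv.
have h1 : t * `|y v| <= \sum_(u | adj v u) `|y u|.
  apply: le_trans (_ : `|t * y v| <= _).
    by rewrite normrM ler_wpM2r // ler_norm.
  by rewrite -yA; apply: ler_norm_sum.
(* The terms are nonnegative by maximality of [M] and their sum is nonpositive, so all vanish: every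
   neighbour is a maximizer. *)
have h2 : \sum_(u | adj v u) (M * z u - `|y u|) <= 0.
  rewrite sumrB subr_le0; apply: le_trans h1.
  by rewrite -mulr_sumr yv mulrCA ler_wpM2l // ltW.
have h3 u : adj v u -> `|y u| == M * z u.
  move=> vu; rewrite eq_sym -subr_eq0; apply/eqP; move: u vu; apply: psumr_eq0P.
    by move=> u _; rewrite subr_ge0.
  by apply/eqP; rewrite eq_le h2 sumr_ge0 // => u _; rewrite subr_ge0.
split=> [|u vu]; last by rewrite inE h3.
apply/eqP; rewrite eq_le zP /= -(ler_pM2l M0) mulrCA -yv mulr_sumr.
by apply: le_trans h1 _; apply: ler_sum => u /h3/eqP->.
Qed.

Lemma eigenvalue_lt a :
  (forall v, \sum_(u | adj v u) z u < t * z v) ->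
  eigenvalue (adjmx R G) a -> a < t.
Proof.
move=> zlt aE; rewrite lt_neqAle eigenvalue_le // andbT.
apply/eqP => at_; move: aE; rewrite at_ => /eigenvalue_tight[S [v vS]].
by move=> /(_ v vS)[ve _]; have := zlt v; rewrite ve ltxx.
Qed.

(* Tightness spreads from a maximizer to all vertices through [r]. *)
Lemma eigenvalue_tight_all (r : G) :
  (\sum_(u | adj r u) z u = t * z r -> forall u, u != r -> adj r u) ->
  (forall v, v != r -> \sum_(u | adj v u) z u = t * z v -> adj v r) ->
  eigenvalue (adjmx R G) t ->
  forall v, \sum_(u | adj v u) z u = t * z v.
Proof.
move=> hr hv /eigenvalue_tight[S [v0 v0S] HS] v.
have rS : r \in S.
  have [<-//|ne] := eqVneq v0 r.
  by have [e0 nS] := HS _ v0S; apply: nS; apply: hv.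
have [<-|ne] := eqVneq r v; first by have [] := HS _ rS.
have [er nS] := HS _ rS.
by have [] := HS v (nS _ (hr er v _)) => //; rewrite eq_sym.
Qed.

End PositiveWeights.

(** The second case is the default of [xget]. Keeping it avoids an existence proof; the bounds that
    follow absorb it by taking [t] nonnegative or positive. *)
Variant spectral_radius_spec (G : sgraph) : R -> Prop :=
  | SpectralRadius t of eigenvalue (adjmx R G) t
      & (forall a, eigenvalue (adjmx R G) a -> a <= t) : spectral_radius_spec G t
  | SpectralRadius0 : spectral_radius_spec G 0.

Lemma spectral_radiusP (G : sgraph) : spectral_radius_spec G (spectral_radius R G).
Proof.
rewrite /spectral_radius /largest_eigenvalue.
by case: classical_sets.xgetP => [t _ [te tmax]|_]; constructor.
Qed.

Lemma spectral_radius_le (G : sgraph) t :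
  0 <= t -> (forall a, eigenvalue (adjmx R G) a -> a <= t) ->
  spectral_radius R G <= t.
Proof. by move=> t0 ht; case: spectral_radiusP => // a /ht. Qed.

Lemma spectral_radius_lt (G : sgraph) t :
  0 < t -> (forall a, eigenvalue (adjmx R G) a -> a < t) ->
  spectral_radius R G < t.
Proof. by move=> t0 ht; case: spectral_radiusP => // a /ht. Qed.

Lemma spectral_radius_eigenvalue (G : sgraph) t :
  0 < t -> spectral_radius R G = t -> eigenvalue (adjmx R G) t.
Proof. by case: spectral_radiusP => [a ? _ _ <-//|+ e]; rewrite e ltxx. Qed.

Lemma spectral_radius_max (G : sgraph) t :
  eigenvalue (adjmx R G) t -> (forall a, eigenvalue (adjmx R G) a -> a <= t) ->
  spectral_radius R G = t.
Proof.
move=> te tmax; rewrite /spectral_radius /largest_eigenvalue.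
by apply: classical_sets.xget_unique => // a [ae amax]; apply/le_anti; rewrite tmax ?amax.
Qed.

(** A positive eigenvector both witnesses [t] and, used as weights, bounds every other
    eigenvalue. *)
Lemma spectral_radius_positive (G : sgraph) (z : G -> R) t :
  (0 < #|G|)%N -> (forall v, 0 < z v) ->
  (forall v, \sum_(u | adj v u) z u = t * z v) -> spectral_radius R G = t.
Proof.
move=> /card_gt0P[v _] z0 zt; apply: spectral_radius_max => [|a].
  by apply/eigenvalue_adjmxP; exists z => //; exists v; rewrite gt_eqF.
by apply: (eigenvalue_le z0) => u; rewrite zt.
Qed.

Lemma giso_sym (G H : sgraph) : giso G H -> giso H G.
Proof.
case=> f [[g fK gK] fA]; exists g; split; first by exists f.
by move=> x y; rewrite -fA !gK.
Qed.

Lemma giso_spectral_radius (G H : sgraph) :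
  giso G H -> spectral_radius R G = spectral_radius R H.
Proof.
have sub (K L : sgraph) a : giso K L ->
    eigenvalue (adjmx R K) a -> eigenvalue (adjmx R L) a.
  case=> f [[g fK gK] fA] /eigenvalue_adjmxP[y [v yv] yA].
  apply/eigenvalue_adjmxP; exists (y \o g) => [|w].
    by exists (f v); rewrite /= fK.
  rewrite /= -yA (reindex f) /=; last by exists g => x _.
  by apply: eq_big => [x|x _]; rewrite ?fK // -{1}(gK w) fA.
move=> GH; have HG := giso_sym GH.
have e a : eigenvalue (adjmx R G) a = eigenvalue (adjmx R H) a.
  by apply/idP/idP; apply: sub.
congr (classical_sets.xget 0 _); apply: classical_sets.eq_set => a.
rewrite e; congr (_ /\ _).
by apply: boolp.eq_forall => b; rewrite e.
Qed.

End Eigenvalues.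

(** Pulled back along [f], the eigenvector of [F] gives admissible weights on [G], and where they
    are tight no edge of [F] is missing. The dominating vertex [r] carries tightness to all
    vertices, which makes [f] an isomorphism. *)
Lemma spanning_subgraph_radius (R : realType) (G F : sgraph) (z : F -> R) (t : R)
    (f : G -> F) (r : F) :
  bijective f -> (forall x y, adj x y -> adj (f x) (f y)) ->
  (forall v, 0 < z v) -> (forall v, \sum_(u | adj v u) z u = t * z v) ->
  (forall v, v != r -> adj v r) ->
  (forall a, eigenvalue (adjmx R G) a -> a <= t) /\
  (eigenvalue (adjmx R G) t -> giso G F).
Proof.
move=> [g fK gK] fadj z0 zt hr.
have sumF (v : G) : t * z (f v) = \sum_(u : G | adj (f v) (f u)) z (f u).
  by rewrite -zt (reindex f) //; exists g => x _.
have le v : \sum_(u | adj v u) z (f u) <= t * z (f v).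
  rewrite sumF big_mkcond [leRHS]big_mkcond; apply: ler_sum => u _ /=.
  case: ifP => [/fadj->//|_]; by case: ifP => // _; apply: ltW.
have tight v : \sum_(u | adj v u) z (f u) = t * z (f v) ->
    forall u, adj (f v) (f u) = adj v u.
  rewrite sumF big_mkcond [RHS]big_mkcond => e u.
  apply/idP/idP => [fvu|]; last exact: fadj.
  apply: contraT => vu; suff : z (f u) = 0 by move=> zu; have := z0 (f u); rewrite zu ltxx.
  have /eqP := e; rewrite eq_sym -subr_eq0 -sumrB => /eqP e0.
  have := @psumr_eq0P _ _ xpredT _ _ e0 u isT; rewrite fvu (negPf vu) subr0.
  apply=> w _; rewrite subr_ge0; case: ifP => [/fadj->//|_].
  by case: ifP => // _; apply: ltW.
split=> [a|te]; first by apply: eigenvalue_le le a => v.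
have all_tight := eigenvalue_tight_all (r := g r) (fun v => z0 (f v)) le _ _ te.
exists f; split; first by exists g.
move=> x y; apply: (tight); apply: all_tight => [e u ur|v vr e].
  by rewrite -(tight _ e) gK adj_sym hr // -(inj_eq (can_inj gK)) fK.
by rewrite -(tight _ e) gK hr // -(inj_eq (can_inj gK)) fK.
Qed.

(** * Weights constant on a vertex set and on its complement *)

Section TwoWeights.
Variable R : realType.

Lemma sum_two_weights (G : sgraph) (L : {set G}) (a b : R) v :
  \sum_(u | adj v u) (if u \in L then a else b) =
  a * #|neighbours v :&: L|%:R + b * #|neighbours v :\: L|%:R.
Proof.
rewrite (bigID (mem L)) /=; congr (_ + _).
  rewrite mulr_natr -sumr_const; apply: eq_big => [u|u /andP[_ ->]//].
  by rewrite !inE.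
rewrite mulr_natr -sumr_const; apply: eq_big => [u|u /andP[_ /negPf->]//].
by rewrite !inE andbC.
Qed.

Lemma card_neighbours_in (G : sgraph) (L : {set G}) v :
  v \in L -> (#|neighbours v :&: L| <= #|L|.-1)%N.
Proof.
move=> vL; rewrite [in leqRHS](cardsD1 v) vL /=; apply: subset_leq_card.
apply/subsetP => x; rewrite !inE => /andP[vx ->]; rewrite andbT.
by apply: contraTneq vx => ->; rewrite adj_irr.
Qed.

Lemma eigenvalue_lt_few_large (G : sgraph) (L : {set G}) m Delta (T : R) :
  (0 < m)%N -> (#|L| <= m)%N ->
  (forall v, v \notin L -> (#|neighbours v| <= Delta)%N) ->
  m%:R - 1 < T -> m%:R * (#|G|%:R + 1) < (T - Delta%:R) * (T - (m%:R - 1)) ->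
  forall a, eigenvalue (adjmx R G) a -> a < T.
Proof.
move=> m0 cL hD mT hT a.
have b0 : 0 < T - (m%:R - 1) by rewrite subr_gt0.
(* With N the order, the bound at a vertex of [L] falls short of T(N + 1) by T - (m - 1) > 0, thanks
   to the added 1. Outside [L] the required inequality is [hT]. *)
pose z u := if u \in L then #|G|%:R + 1 else T - (m%:R - 1).
have z0 v : 0 < z v by rewrite /z; case: ifP => // _; rewrite ltr_wpDl.
have zlt v : \sum_(u | adj v u) z u < T * z v.
  rewrite sum_two_weights /z; case: ifPn => vL.
    apply: le_lt_trans
      (_ : (#|G|%:R + 1) * (m%:R - 1) + (T - (m%:R - 1)) * #|G|%:R < _); last by nra.
    apply: lerD; rewrite ler_wpM2l ?(ltW b0) ?addr_ge0 //; last first.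
      by rewrite ler_nat; apply: max_card.
    rewrite lerBrDr natr1 ler_nat.
    by have := card_neighbours_in vL; have := cardsD1 v L; rewrite vL; lia.
  apply: le_lt_trans
    (_ : (#|G|%:R + 1) * m%:R + (T - (m%:R - 1)) * Delta%:R < _); last by nra.
  apply: lerD; rewrite ler_wpM2l ?(ltW b0) ?addr_ge0 // ler_nat.
    exact: leq_trans (subset_leq_card (subsetIr _ _)) cL.
  exact: leq_trans (subset_leq_card (subsetDl _ _)) (hD _ vL).
by apply: (eigenvalue_lt z0 _ zlt) => v; apply: ltW.
Qed.

Section SmallOutside.
Variables (G : sgraph) (L : {set G}) (r : nat) (t : R).
Hypothesis L_gt0 : (0 < #|L|)%N.
Hypothesis outside : forall v, v \notin L -> (#|neighbours v :\: L| <= r)%N.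
Hypothesis rt : r%:R < t.
Hypothesis tE :
  (t - (#|L|%:R - 1)) * (t - r%:R) = #|L|%:R * (#|G|%:R - #|L|%:R).

(** The eigenvector of the join of a complete graph on [L] with an r-regular graph: its equation is
    [tE] on [L] and an identity outside. *)
Let z u : R := if u \in L then t - r%:R else #|L|%:R.

Let z_gt0 v : 0 < z v.
Proof. by rewrite /z; case: ifP => _; rewrite ?subr_gt0 ?ltr0n. Qed.

Let n_eq : #|G|%:R - #|L|%:R = #|~: L|%:R :> R.
Proof. by rewrite -(cardsC L) natrD addrAC subrr add0r. Qed.

Let L_eq : #|L|%:R - 1 = #|L|.-1%:R :> R.
Proof. by rewrite -{1}(prednK L_gt0) -natr1 addrK. Qed.

Let zP v : \sum_(u | adj v u) z u <= t * z v.
Proof.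
rewrite sum_two_weights /z; case: ifPn => vL.
  apply: le_trans (_ : (t - r%:R) * #|L|.-1%:R + #|L|%:R * #|~: L|%:R <= _).
    apply: lerD; rewrite ler_wpM2l ?ler_nat ?subr_ge0 ?(ltW rt) //.
      exact: card_neighbours_in.
    by apply: subset_leq_card; rewrite finset.setDE subsetIr.
  by rewrite -n_eq -tE L_eq; lra.
apply: le_trans (_ : (t - r%:R) * #|L|%:R + #|L|%:R * r%:R <= _); last by lra.
apply: lerD; rewrite ler_wpM2l ?ler_nat ?subr_ge0 ?(ltW rt) ?outside //.
by apply: subset_leq_card; rewrite subsetIr.
Qed.

Lemma eigenvalue_le_small_outside a : eigenvalue (adjmx R G) a -> a <= t.
Proof. exact: eigenvalue_le z_gt0 zP a. Qed.

(** Both neighbour counts are bounded and have positive coefficients, so equality of the weighted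
    sums forces each count to be maximal. The same argument gives [tight_out]. *)
Let tight_in v : v \in L -> \sum_(u | adj v u) z u = t * z v ->
  forall u, u != v -> adj v u.
Proof.
move=> vL; rewrite sum_two_weights /z vL => e u uv.
have t0 : 0 < t - r%:R by rewrite subr_gt0.
have L0 : 0 < #|L|%:R :> R by rewrite ltr0n.
have c1 := card_neighbours_in vL.
have c2 : (#|neighbours v :\: L| <= #|~: L|)%N.
  by apply: subset_leq_card; rewrite finset.setDE subsetIr.
have {}e : (t - r%:R) * #|neighbours v :&: L|%:R +
    #|L|%:R * #|neighbours v :\: L|%:R = (t - r%:R) * #|L|.-1%:R + #|L|%:R * #|~: L|%:R.
  by rewrite e -n_eq -tE L_eq; lra.
have e1 : #|neighbours v :&: L| = #|L|.-1.
  apply/eqP; rewrite eqn_leq c1 /= -(ler_nat R) -(ler_pM2l t0).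
  by move: c2; rewrite -(ler_nat R) -(ler_pM2l L0); lra.
have e2 : #|neighbours v :\: L| = #|~: L|.
  apply/eqP; rewrite eqn_leq c2 /= -(ler_nat R) -(ler_pM2l L0).
  by move: c1; rewrite -(ler_nat R) -(ler_pM2l t0); lra.
have : neighbours v = ~: [set v].
  apply/eqP; rewrite eqEcard; apply/andP; split.
    apply/subsetP => x; rewrite !inE => vx.
    by apply: contraTneq vx => ->; rewrite adj_irr.
  rewrite -[X in (_ <= X)%N](cardsID L) e1 e2.
  by have := cardsC L; have := cardsC [set v]; rewrite cards1; lia.
by move=> /setP/(_ u); rewrite !inE uv.
Qed.

Let tight_out v : v \notin L -> \sum_(u | adj v u) z u = t * z v ->
  (forall u, u \in L -> adj v u) /\ #|neighbours v :\: L| = r.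
Proof.
move=> vL; rewrite sum_two_weights /z (negPf vL) => e.
have t0 : 0 < t - r%:R by rewrite subr_gt0.
have L0 : 0 < #|L|%:R :> R by rewrite ltr0n.
have c1 : (#|neighbours v :&: L| <= #|L|)%N.
  by apply: subset_leq_card; rewrite subsetIr.
have c2 := outside vL.
have e1 : #|neighbours v :&: L| = #|L|.
  apply/eqP; rewrite eqn_leq c1 /= -(ler_nat R) -(ler_pM2l t0).
  by move: c2; rewrite -(ler_nat R) -(ler_pM2l L0); lra.
split=> [u uL|]; last first.
  apply/eqP; rewrite eqn_leq c2 /= -(ler_nat R) -(ler_pM2l L0).
  by move: c1; rewrite -(ler_nat R) -(ler_pM2l t0); lra.
have /eqP/setP/(_ u) : neighbours v :&: L == L.
  by rewrite eqEcard subsetIr e1 leqnn.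
by rewrite !inE uL andbT.
Qed.

Lemma small_outside_tight :
  eigenvalue (adjmx R G) t ->
  (forall v u, v \in L -> u != v -> adj v u) /\
  (forall v, v \notin L -> #|neighbours v :\: L| = r).
Proof.
move=> te; have /card_gt0P[w wL] := L_gt0.
have all_tight := eigenvalue_tight_all z_gt0 zP (tight_in wL) _ te.
have {}all_tight v : \sum_(u | adj v u) z u = t * z v.
  apply: all_tight => {}v vw e; have [vL|vL] := boolP (v \in L).
    by apply: tight_in => //; rewrite eq_sym.
  by have [->] := tight_out vL e.
split=> [v u vL|v vL]; first exact: tight_in.
by have [] := tight_out vL (all_tight v).
Qed.

End SmallOutside.
End TwoWeights.

(** * The subgraph induced outside a vertex set *)

Section InducedOutside.
Variables (G : sgraph) (L : {set G}).
Definition outside_adj : rel {x : G | x \notin L} := fun x y => adj (val x) (val y).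
Lemma outside_adj_sym : symmetric outside_adj.
Proof. by move=> x y; rewrite /outside_adj adj_sym. Qed.
Lemma outside_adj_irr : irreflexive outside_adj.
Proof. by move=> x; rewrite /outside_adj adj_irr. Qed.
Definition outside_graph : sgraph := SGraph outside_adj_sym outside_adj_irr.

Lemma outside_order : graph_order outside_graph = (#|G| - #|L|)%N.
Proof.
rewrite /graph_order /= card_sub -(cardsC L) addKn; apply: eq_card => x.
by rewrite !inE.
Qed.

Lemma outside_regular r :
  (forall v, v \notin L -> #|neighbours v :\: L| = r) -> is_regular r outside_graph.
Proof.
move=> h [v vL]; rewrite -(h v vL) -(card_image val_inj); apply: eq_card => u.
apply/imageP/idP => [[[w wL] vw ->]|]; first by rewrite !inE wL.
by rewrite !inE => /andP[uL vu]; exists (exist _ u uL).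
Qed.

Lemma giso_join_outside :
  (forall v u, v \in L -> u != v -> adj v u) ->
  giso G (graph_join (complete #|L|) outside_graph).
Proof.
move=> hL; apply: giso_sym.
pose f (w : graph_join (complete #|L|) outside_graph) : G :=
  match w with inl i => enum_val i | inr x => val x end.
have finj : injective f.
  move=> [i|[x xL]] [j|[y yL]] /= e.
  - by rewrite (enum_val_inj e).
  - by have := enum_valP i; rewrite e (negPf yL).
  - by have := enum_valP j; rewrite -e (negPf xL).
  - by congr inr; apply: val_inj.
exists f; split.
  apply: inj_card_bij finj _; rewrite /= card_sum card_ord.
  have := outside_order; rewrite /graph_order /= => ->.
  by have := max_card (mem L); lia.
have neq (i : 'I_#|L|) (x : G) : x \notin L -> x != enum_val i :> G.
  by move=> xL; apply: contraNneq xL => ->; exact: enum_valP i.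
move=> [i|[x xL]] [j|[y yL]] //=.
- rewrite /complete_adj; have [->|ij] := eqVneq i j; first by rewrite adj_irr.
  by rewrite hL ?enum_valP // (inj_eq enum_val_inj) eq_sym.
- by rewrite hL ?enum_valP ?neq.
- by rewrite adj_sym hL ?enum_valP ?neq.
Qed.

End InducedOutside.

(** * Spectral radii of joins *)

Section Joins.
Variable R : realType.

Lemma sum_complete m (v : complete m) (a : R) :
  \sum_(u | adj v u) a = (m%:R - 1) * a.
Proof.
rewrite sumr_const -[LHS]mulr_natl; congr (_ * _).
have -> : #|(fun u => adj v u)| = m.-1.
  have := cardC1 v; rewrite card_ord => <-; apply: eq_card => u.
  by rewrite !inE /= unfold_in /= /complete_adj eq_sym.
by rewrite -[in RHS](prednK (leq_ltn_trans (leq0n v) (ltn_ord v))) -natr1 addrK.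
Qed.

Lemma sum_regular (H : sgraph) r (v : H) (a : R) :
  is_regular r H -> \sum_(u | adj v u) a = r%:R * a.
Proof. by move=> /(_ v) <-; rewrite sumr_const -[LHS]mulr_natl. Qed.

Lemma join_complete_regular_radius (H : sgraph) m r (t : R) :
  (0 < m)%N -> is_regular r H -> r%:R < t ->
  (t - (m%:R - 1)) * (t - r%:R) = m%:R * (graph_order H)%:R ->
  spectral_radius R (graph_join (complete m) H) = t.
Proof.
move=> m0 Hr rt tE.
pose z (w : graph_join (complete m) H) : R := if w is inl _ then t - r%:R else m%:R.
apply: (@spectral_radius_positive _ _ z).
- by apply/card_gt0P; exists (inl (Ordinal m0)).
- by move=> [i|x]; rewrite /z ?subr_gt0 ?ltr0n.
- move=> [i|x]; rewrite big_sumType /=.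
    rewrite sum_complete sumr_const -[m%:R *+ _]mulr_natr -/(graph_order H) -tE; lra.
  rewrite (sum_regular _ _ Hr) sumr_const card_ord -[_ *+ m]mulr_natr; lra.
Qed.

(** [t] is the larger root of the quadratic. The last bound serves for comparison with graphs having
    few large vertices; the difference is (k + dk - 3)t - (k - 2)(dk - 1), nonnegative since t > dk
    - 1. *)
Lemma rho_boundP n k dk : (2 <= k)%N -> (k <= n)%N -> (1 <= dk)%N ->
  let t := rho_bound R n k dk in
  [/\ (dk - 1)%N%:R < t, 0 < t,
      (t - ((k - 1)%N%:R - 1)) * (t - (dk - 1)%N%:R) = (k - 1)%N%:R * (n%:R - (k - 1)%N%:R)
    & (k - 1)%N%:R * (n%:R - (k - 1)%N%:R) <= t ^+ 2].
Proof.
move=> k2 kn d1 t.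
rewrite !natrB ?(ltnW k2) //.
have : 2 <= k%:R :> R by rewrite ler_nat.
have : k%:R <= n%:R :> R by rewrite ler_nat.
have : 1 <= dk%:R :> R by rewrite ler1n.
rewrite {}/t /rho_bound; move: k%:R dk%:R n%:R => {k2 kn d1 dk k n} k d n d1 kn k2.
set s := Num.sqrt _.
have s2 : s ^+ 2 = (k - d - 1) ^+ 2 + 4 * (k - 1) * (n - k + 1).
  by rewrite sqr_sqrtr // addr_ge0 ?sqr_ge0 // !mulr_ge0 //; lra.
have s0 : 0 <= s by apply: sqrtr_ge0.
have p0 : 0 < (k - 1) * (n - k + 1) by rewrite mulr_gt0 //; lra.
(* As [p0] is positive, the root [s] exceeds |k - d - 1|; this puts t above both k - 2 and d - 1. *)
have hs1 : k - d - 1 < s by rewrite ltNge; apply/negP => h; nra.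
have hs2 : d + 1 - k < s by rewrite ltNge; apply/negP => h; nra.
split; [lra|lra|nra|nra].
Qed.

End Joins.

(** * Joins of a complete graph with a matching *)

Section JoinMatching.
Variable R : realType.

Lemma copies_K2_regular p : is_regular 1 (copies p (complete 2)).
Proof.
move=> [i x]; apply: etrans (card1 (existT (fun=> 'I_2) i (rev_ord x))).
apply: eq_card => -[j y]; rewrite !inE /= /bigunion_adj /= -tag_eqE /tag_eq /=.
rewrite [j == i]eq_sym; case: (eqVneq i j) => //= ij.
move: ij y => <- y; rewrite !tagged_asE /complete_adj.
by case: x y => [[|[|x]] hx] [[|[|y]] hy].
Qed.

(** The characteristic equation of the quotient matrix of the join for its classes of m clique, 2p
    matched and s unmatched vertices. *)
Lemma cubic_root (m p s : R) : 1 <= m -> 1 <= p -> 0 <= s -> 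
  exists2 t : R, 1 < t &
    (t - (m - 1)) * (t - 1) * t = 2 * p * m * t + s * m * (t - 1).
Proof.
move=> m1 p1 s0.
pose P : {poly R} := ('X - (m - 1)%:P) * ('X - 1) * 'X - (2 * p * m) *: 'X - (s * m) *: ('X - 1).
have PE t : P.[t] = (t - (m - 1)) * (t - 1) * t - 2 * p * m * t - s * m * (t - 1).
  by rewrite /P !hornerE.
(* The order of the join. The cubic is nonpositive at 1 and nonnegative at n, and 1 is not a
   root. *)
pose n := m + 2 * p + s.
have pm0 : 0 < p * m by rewrite mulr_gt0 //; lra.
have n1 : 1 <= n by rewrite /n; lra.
have P1 : P.[1] <= 0 by rewrite PE; lra.
have Pn : 0 <= P.[n].
  have mn : 0 <= n - 1 - m by rewrite /n; lra.
  have h1 : 0 <= p * (n * (n - 1 - m)) by rewrite !mulr_ge0 //; lra.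
  have h2 : 0 <= s * ((n - 1) * (n - m)) by rewrite !mulr_ge0 //; lra.
  have h3 : 0 <= (n - 1) * n by rewrite mulr_ge0 //; lra.
  have -> : P.[n] = 2 * (p * (n * (n - 1 - m))) + s * ((n - 1) * (n - m)) + (n - 1) * n.
    by rewrite PE /n; ring.
  lra.
have [|t /andP[t1 _] /rootP] := @poly_ivt R P 1 n n1; first by rewrite P1.
rewrite PE => tE; exists t; last by lra.
by rewrite lt_neqAle t1 andbT; apply/eqP => e; move: tE; rewrite -e; lra.
Qed.

Lemma join_matching_radius m p s : (0 < m)%N -> (0 < p)%N -> (s < 2)%N ->
  let F := graph_join (complete m) (matching_graph p s) in
  exists z : F -> R, exists2 t, 0 < t /\ m%:R * (2 * p + s)%N%:R <= t ^+ 2 &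
   (forall v, 0 < z v) /\ (forall v, \sum_(u | adj v u) z u = t * z v).
Proof.
move=> m0 p0 s2 F.
have m1 : 1 <= m%:R :> R by rewrite ler1n.
have p1 : 1 <= p%:R :> R by rewrite ler1n.
have s0 : 0 <= s%:R :> R by [].
have [t t1 tE] := cubic_root m1 p1 s0.
(* The equations at matched and unmatched vertices are identities; the one at the clique is the
   cubic. *)
pose z (w : F) : R := match w with
  | inl _ => (t - 1) * t
  | inr (inl _) => m%:R * t
  | inr (inr _) => m%:R * (t - 1) end.
have t0 : 0 < t by lra.
have t10 : 0 < t - 1 by lra.
have mR : 0 < m%:R :> R by rewrite ltr0n.
have tE' : (t - (m%:R - 1)) * ((t - 1) * t) = p%:R * 2 * (m%:R * t) + s%:R * (m%:R * (t - 1)).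
  by rewrite mulrA tE; ring.
exists z, t.
  split=> //; rewrite natrD natrM -subr_ge0.
  (* After multiplication by t - 1 the cubic turns the difference into a sum of nonnegative
     terms. *)
  rewrite -(pmulr_lge0 _ t10).
  have -> : (t ^+ 2 - m%:R * (2 * p%:R + s%:R)) * (t - 1) =
    (m%:R - 1) * (t * (t - 1)) + m%:R * (2 * p%:R).
    transitivity ((t - (m%:R - 1)) * (t - 1) * t + (m%:R - 1) * t * (t - 1)
                  - m%:R * (2 * p%:R + s%:R) * (t - 1)); first by ring.
    rewrite tE; ring.
  by rewrite addr_ge0 // mulr_ge0 ?subr_ge0 ?mulr_ge0 // ltW.
split=> [v|].
  by case: v => [i|[x|x]]; apply: mulr_gt0.
have c2 : #|copies p (complete 2)| = (p * 2)%N.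
  by rewrite card_tagged sumnE big_map big_enum /= sum_nat_const !card_ord.
move=> v; rewrite big_sumType /= big_sumType /=; case: v => [i|[x|x]] /=.
- rewrite sum_complete !sumr_const c2 card_ord -[_ *+ (p * 2)]mulr_natl.
  by rewrite -[_ *+ s]mulr_natl natrM -tE'; ring.
- rewrite big_pred0_eq (sum_regular _ _ (@copies_K2_regular p)) sumr_const card_ord.
  by rewrite -[_ *+ m]mulr_natl; ring.
- rewrite sumr_const card_ord big_pred0_eq sum_complete -[_ *+ m]mulr_natl.
  (* An unmatched vertex exists only if s = 1, and then has no neighbour in its own part. *)
  have -> : s%:R = 1 :> R by case: s s2 x {tE tE' s0 F z} => [|[|]] // _ [].
  by ring.
Qed.

End JoinMatching.

(** * The extremal problem *)

(** For k = 2 the right side is 0 and the left side positive. For k >= 3, 2D + 5k - 8 >= 4k, whose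
    fourth power 256 k^4 leaves the factor 256 k after division by k - 2. *)
Lemma order_large k n D : (2 <= k <= D)%N ->
  ((2 * D + 5 * k - 8) ^ 4 * (D + k - 2) ^ 4 <= n * (k - 2))%N ->
  (3 <= k /\ 256 * (k * (D + k - 2) ^ 2) <= n)%N.
Proof.
move=> /andP[k2 kD] h.
have k3 : (3 <= k)%N.
  rewrite ltn_neqAle k2 andbT; apply/eqP => e; move: h; rewrite -e subnn muln0 leqn0.
  by rewrite muln_eq0 !expn_eq0 /=; lia.
split=> //; have k20 : (0 < k - 2)%N by rewrite subn_gt0.
rewrite -(leq_pmul2r k20); apply: leq_trans h.
have h1 : (k - 2 <= 4 * k)%N by lia.
have h2 : (4 * k <= 2 * D + 5 * k - 8)%N by lia.
have -> : (256 * (k * (D + k - 2) ^ 2) * (k - 2) =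
          (64 * k * (k - 2) * 4) * (D + k - 2) ^ 2)%N by lia.
apply: leq_mul.
  apply: leq_trans (_ : (4 * k) ^ 4 <= _)%N; last by rewrite leq_exp2r.
  have -> : ((4 * k) ^ 4 = (64 * k * k * 4) * (k * k))%N by rewrite expnMn !expnS expn0; lia.
  apply: leq_trans (leq_pmulr _ _); last by rewrite muln_gt0; lia.
  by rewrite !leq_mul // leq_subr.
by rewrite leq_pexp2l //; lia.
Qed.

(** T^2 exceeds (K - 2)N by nearly N, while XT and (K - 3)T are each at most N/16. *)
Lemma large_order_gap (R : realType) (K N X : R) :
  3 <= K -> K <= X -> 256 * (K * X ^+ 2) <= N ->
  let T := Num.sqrt ((K - 1) * (N - (K - 1))) in
  [/\ 0 < T, K - 2 - 1 < T & (K - 2) * (N + 1) < (T - X) * (T - (K - 2 - 1))].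
Proof.
move=> K3 KX hN T.
have X2 : X <= X ^+ 2 by rewrite expr2 ler_peMl //; lra.
have KX2 : X ^+ 2 <= K * X ^+ 2 by rewrite ler_peMl ?sqr_ge0 //; lra.
have KK : K ^+ 2 <= X ^+ 2 by rewrite lerXn2r ?nnegrE //; lra.
have T2 : T ^+ 2 = (K - 1) * (N - (K - 1)).
  rewrite sqr_sqrtr // mulr_ge0 //; lra.
have T0 : 0 <= T by apply: sqrtr_ge0.
have hT : 16 * (X * T) <= N.
  rewrite -ler_sqr ?nnegrE; [|rewrite !mulr_ge0 //; lra|lra].
  rewrite !exprMn T2.
  have h1 : (K - 1) * (N - (K - 1)) <= K * N by apply: ler_pM; lra.
  have h2 : X ^+ 2 * ((K - 1) * (N - (K - 1))) <= X ^+ 2 * (K * N) by rewrite ler_wpM2l ?sqr_ge0.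
  have h3 : 256 * (K * X ^+ 2) * N <= N * N by rewrite ler_wpM2r //; lra.
  have -> : 16 ^+ 2 = 256 :> R by rewrite expr2 -natrM.
  rewrite [N ^+ 2]expr2; apply: le_trans h3.
  have -> : 256 * (K * X ^+ 2) * N = 256 * (X ^+ 2 * (K * N)) by ring.
  lra.
have KT : K < T.
  rewrite -ltr_sqr ?nnegrE //; last lra.
  rewrite T2; apply: lt_le_trans (_ : 1 * (N - (K - 1)) <= _); first lra.
  by apply: ler_wpM2r; lra.
have XT : (K - 3) * T <= X * T by rewrite ler_wpM2r //; lra.
split; [lra|lra|].
have -> : (T - X) * (T - (K - 2 - 1)) = T ^+ 2 - X * T - (K - 3) * T + X * (K - 3) by ring.
have : 0 <= X * (K - 3) by rewrite mulr_ge0; lra.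
rewrite T2; have -> : (K - 1) * (N - (K - 1)) = (K - 2) * N + N - (K ^+ 2 - 2 * K + 1) by ring.
lra.
Qed.

Theorem theorem1p7 (R : realType) (k : nat) (d : nat -> nat) (n : nat)
  (G : sgraph)
  (hk : (2 <= k)%N)
  (hd_noninc : forall i : nat, (1 <= i)%N -> (i < k)%N -> (d i.+1 <= d i)%N)
  (hd_pos : (1 <= d k)%N)
  (hG_free : H_free (star_forest k d) G)
  (hG_order : graph_order G = n)
  (* division by k - 2 cleared; unsatisfiable for k = 2 *)
  (hn : ((\sum_(1 <= i < k.+1) 2 * d i + 5 * k - 8) ^ 4
         * (\sum_(1 <= i < k.+1) d i + k - 2) ^ 4 <= n * (k - 2))%N) :
  spectral_radius R G <= rho_bound R n k (d k)
  /\ (spectral_radius R G = rho_bound R n k (d k) <->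
      exists H : sgraph,
        [/\ is_regular (d k - 1) H, graph_order H = (n - k + 1)%N
          & giso G (graph_join (complete (k - 1)) H)])
  /\ (d k = 2%N ->
      spectral_radius R G <= spectral_radius R (F_graph n k)
      /\ (spectral_radius R G = spectral_radius R (F_graph n k) <->
          giso G (F_graph n k))).
Proof.
(* Monotonicity gives d_i >= d_k >= 1 for all i, hence D >= k. *)
have d_ge j : (j < k)%N -> (d k <= d (k - j))%N.
  elim: j => [|j IH] jk; first by rewrite subn0.
  apply: leq_trans (IH (ltnW jk)) _.
  by rewrite -(subnSK (ltnW jk)) hd_noninc; lia.
have kD : (k <= \sum_(1 <= i < k.+1) d i)%N.
  rewrite -[leqLHS]muln1 -[leqLHS](_ : \sum_(1 <= i < k.+1) 1 = _)%N; last first.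
    by rewrite sum_nat_const_nat subn1.
  rewrite big_nat [leqRHS]big_nat; apply: leq_sum => i /andP[i1 ik].
  by apply: leq_trans hd_pos _; have := d_ge (k - i)%N; rewrite subKn //; apply; lia.
rewrite -big_distrr /= in hn.
have [k3 nlarge] := order_large (introT andP (conj hk kD)) hn.
have cL := card_large_vertices hG_free (ltnW hk).
have cOut := card_neighbours_outside hG_free.
move: kD nlarge cL cOut; set D := (\sum_(1 <= i < k.+1) d i)%N => kD nlarge.
set L := large_vertices _ _ => cL cOut.
have cG : #|G| = n by [].
have kn : (k <= n)%N.
  apply: leq_trans nlarge; apply: leq_trans (leq_pmull _ _) => //.
  by apply: leq_pmulr; rewrite expn_gt0; lia.
set t := rho_bound R n k (d k).
have [rt t0 tE tT] := rho_boundP R hk kn hd_pos; rewrite -/t in rt t0 tE tT.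
(* The spectral radius of the complete bipartite graph with parts k - 1 and n - k + 1. Graphs with
   fewer than k - 1 large vertices stay below it; both extremal values are at least [T]. *)
pose T : R := Num.sqrt ((k%:R - 1) * (n%:R - (k%:R - 1))).
have km1 : (k - 1)%N%:R = k%:R - 1 :> R by rewrite natrB // ltnW.
have km2 : (k - 2)%N%:R = k%:R - 2 :> R by rewrite natrB.
have [T0 kT gap] : [/\ 0 < T, k%:R - 2 - 1 < T &
    (k%:R - 2) * (n%:R + 1) < (T - (D + k - 2)%N%:R) * (T - (k%:R - 2 - 1))].
  apply: large_order_gap; rewrite -?natrX -?natrM ?ler_nat //; lia.
have T2 : T ^+ 2 = (k - 1)%N%:R * (n%:R - (k - 1)%N%:R).
  rewrite km1 sqr_sqrtr // -km1 mulr_ge0 // subr_ge0 ler_nat; lia.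
have le_T x : 0 < x -> T ^+ 2 <= x ^+ 2 -> T <= x.
  by move=> x0; rewrite ler_sqr // nnegrE ltW.
have few : (#|L| < k - 1)%N -> forall a, eigenvalue (adjmx R G) a -> a < T.
  move=> cL'; apply: (@eigenvalue_lt_few_large _ _ L (k - 2) (D + k - 2)).
  - by lia.
  - by lia.
  - by move=> v; rewrite inE -ltnNge; lia.
  - by rewrite km2.
  - by rewrite km2 cG.
have join_t : (exists H : sgraph, [/\ is_regular (d k - 1) H,
    graph_order H = (n - k + 1)%N & giso G (graph_join (complete (k - 1)) H)]) ->
    spectral_radius R G = t.
  case=> H [Hr cH /(giso_spectral_radius R)->].
  apply: join_complete_regular_radius Hr rt _; first lia.
  rewrite tE cH; congr (_ * _); rewrite -natrB; [congr _%:R|]; lia.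
have F_radius : d k = 2%N -> exists2 x, 0 < x /\ T ^+ 2 <= x ^+ 2 &
    spectral_radius R (F_graph n k) = x /\
    (#|L| = (k - 1)%N -> (forall a, eigenvalue (adjmx R G) a -> a <= x) /\
                     (eigenvalue (adjmx R G) x -> giso G (F_graph n k))).
  (* Two vertices outside the clique make the matching nonempty, as [join_matching_radius]
     requires. *)
  move=> dk2; have nk2 : (2 <= n - (k - 1))%N.
    have : (2 ^ 2 <= (D + k - 2) ^ 2)%N by rewrite leq_exp2r //; lia.
    by move: nlarge; rewrite /=; nia.
  pose p := ((n - (k - 1)) %/ 2)%N; pose s := ((n - (k - 1)) %% 2)%N.
  have k0 : (0 < k - 1)%N by lia.
  have p0 : (0 < p)%N by rewrite divn_gt0.
  have s2 : (s < 2)%N by rewrite ltn_mod.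
  have ps : (2 * p + s = n - (k - 1))%N by rewrite mulnC -divn_eq.
  have [z [x [x0 xT] [z0 zx]]] := join_matching_radius R k0 p0 s2.
  exists x; first by split=> //; rewrite T2 -natrB -?ps //; lia.
  split.
    apply: spectral_radius_positive z0 zx.
    by apply/card_gt0P; exists (inl (Ordinal k0)).
  move=> cLk; have L0 : (0 < #|L|)%N by rewrite cLk.
  have [||f fbij fadj] := @embed_join_matching G L p s L0 s2.
  - by move=> v vL; rewrite -ltnS -dk2 cOut // cLk; lia.
  - by rewrite cG cLk -mul2n ps; lia.
  rewrite cLk in f fbij fadj.
  pose r : graph_join (complete (k - 1)) (matching_graph p s) := inl (Ordinal k0).
  apply: (spanning_subgraph_radius (r := r) fbij fadj z0 zx).
  by move=> [i|u] //=; apply: contraNneq => ->.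
(* With fewer than k - 1 large vertices both inequalities are strict, so both sides of each
   equivalence fail. *)
have [few_L|many] := ltnP #|L| (k - 1).
  have lt_x x : 0 < x -> T ^+ 2 <= x ^+ 2 -> spectral_radius R G < x.
    move=> x0 /(le_T _ x0) Tx; apply: lt_le_trans Tx.
    exact: spectral_radius_lt T0 (few few_L).
  have Gt : spectral_radius R G < t by apply: lt_x; rewrite ?T2.
  split; first exact: ltW.
  split; first by split=> [e|/join_t e]; move: Gt; rewrite e ltxx.
  move=> /F_radius[x [x0 xT] [Fx _]]; have Gx := lt_x x x0 xT.
  rewrite Fx; split; first exact: ltW.
  by split=> [e|/(giso_spectral_radius R) e]; move: Gx; rewrite ?e ?Fx ltxx.
have cLk : #|L| = (k - 1)%N by lia.
have L0 : (0 < #|L|)%N by rewrite cLk; lia.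
have out v : v \notin L -> (#|neighbours v :\: L| <= d k - 1)%N.
  by move=> vL; have := cOut v _ vL; rewrite cLk; lia.
rewrite -cLk -cG in tE.
split; first exact: spectral_radius_le (ltW t0) (eigenvalue_le_small_outside L0 out rt tE).
split; first split=> [Gt|/join_t //].
  have [hin hout] := small_outside_tight L0 out rt tE (spectral_radius_eigenvalue t0 Gt).
  exists (outside_graph L); split; first exact: outside_regular.
    by rewrite outside_order cG cLk; lia.
  by rewrite -cLk; apply: giso_join_outside.
move=> /[dup] dk2 /F_radius[x [x0 _] [Fx /(_ cLk)[Gx Gx_eq]]].
rewrite Fx; split; first exact: spectral_radius_le (ltW x0) Gx.
split=> [Gx'|/(giso_spectral_radius R)->//].
exact: Gx_eq (spectral_radius_eigenvalue x0 Gx').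
Qed.
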